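(* Let $\mathcal{D}$ be a triangulated category with a presilting subcategory $\mathcal{P}$ such that $\mathcal{P}$ is contravariantly finite in $\mathcal{D}$, there is an integer $m<0$ with $\operatorname{Hom}(\mathcal{P},\mathcal{P}[i])=0$ for all $i<m$, and $(\mathcal{D}^{\le 0}_{\mathcal{P}},\mathcal{D}^{\ge 0}_{\mathcal{P}})$ is a non-degenerate $t$-structure on $\mathcal{D}$. Let $d$ be a positive integer and $d\text{-}\mathcal{H}=\mathcal{D}^{[-d+1,0]}$, and assume $\mathcal{P}\subseteq d\text{-}\mathcal{H}$. Let $\mathcal{M}$ be a contravariantly finite $\mathbb{E}$-universal subcategory of $d\text{-}\mathcal{H}$. Then the following are equivalent. (1) $\mathcal{M}$ is a tilting subcategory of $d\text{-}\mathcal{H}$. (2) $\mathcal{M}$ is its own $\mathcal{P}$-presentation and is AIR tilting with respect to itself. (3) $\mathcal{M}\subseteq\mathcal{P}^{[0,d]}$ and $\mathcal{T}(\mathcal{M})=\operatorname{Fac}_d(\mathcal{M})=\operatorname{Fac}_{d+1}(\mathcal{M})$. (4) $\mathcal{M}\subseteq\mathcal{P}^{[0,d]}\cap\mathcal{T}(\mathcal{M})$, and for any $X\in\mathcal{T}(\mathcal{M})$ there exists an extriangle $Z\to M\to X$ with $M\in\mathcal{M}$ and $Z\in\mathcal{T}(\mathcal{M})$.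
   Context: Conventions: $[1]$ is the shift functor of a triangulated category. $\operatorname{add}\mathcal{X}$ is the full subcategory of direct summands of finite direct sums of objects of $\mathcal{X}$. A subcategory of an additive category means a full subcategory $\mathcal{X}$ with $\mathcal{X}=\operatorname{add}\mathcal{X}$. $\operatorname{Hom}(\mathcal{X},\mathcal{Y})=0$ means $\operatorname{Hom}(X,Y)=0$ for all $X\in\mathcal{X}$, $Y\in\mathcal{Y}$, similarly for other bifunctors. A morphism $f:X\to Y$ is a right $\mathcal{X}$-approximation of $Y$ if $X\in\mathcal{X}$ and every morphism $X'\to Y$ with $X'\in\mathcal{X}$ factors through $f$; $\mathcal{X}$ is contravariantly finite in $\mathcal{C}$ if every object of $\mathcal{C}$ has a right $\mathcal{X}$-approximation. $\mathcal{P}$ is presilting if $\operatorname{Hom}(\mathcal{P},\mathcal{P}[i])=0$ for all $i>0$. $\mathcal{D}^{\le 0}_{\mathcal{P}}=\{Y\in\mathcal{D}\mid \operatorname{Hom}(\mathcal{P},Y[i])=0\ \forall i>0\}$, $\mathcal{D}^{\ge 0}_{\mathcal{P}}=\{Y\in\mathcal{D}\mid \operatorname{Hom}(\mathcal{P},Y[i])=0\ \forall i<0\}$, $\mathcal{D}^{\le q}=\mathcal{D}^{\le 0}_{\mathcal{P}}[-q]$, $\mathcal{D}^{\ge q}=\mathcal{D}^{\ge 0}_{\mathcal{P}}[-q]$, $\mathcal{D}^{[p,q]}=\mathcal{D}^{\le q}\cap\mathcal{D}^{\ge p}$, and $H^{[p,q]}=\sigma^{\ge p}\circ\sigma^{\le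 q}:\mathcal{D}\to\mathcal{D}^{[p,q]}$ with $\sigma$ the truncations of the $t$-structure $(\mathcal{D}^{\le 0}_{\mathcal{P}},\mathcal{D}^{\ge 0}_{\mathcal{P}})$. $\mathcal{K}=\operatorname{thick}(\mathcal{P})$ is the smallest triangulated subcategory of $\mathcal{D}$ closed under direct summands and containing $\mathcal{P}$. $\mathcal{X}*\mathcal{Y}$ is the full subcategory of objects $Z$ admitting a triangle $X\to Z\to Y\to X[1]$ with $X\in\mathcal{X}$, $Y\in\mathcal{Y}$; $\mathcal{P}^{[0,d]}=\mathcal{P}*\mathcal{P}[1]*\cdots*\mathcal{P}[d]$. A subcategory $\mathcal{S}$ of $\mathcal{K}$ is $(d+1)$-term if $\mathcal{S}\subseteq\mathcal{P}^{[0,d]}$. For $M,N\in d\text{-}\mathcal{H}$ and $i>0$ put $\mathbb{E}^i(M,N)=\operatorname{Hom}(M,N[i])$ and $\mathbb{E}=\mathbb{E}^1$. An extriangle is a sequence $N\to L\to M$ with $N,L,M\in d\text{-}\mathcal{H}$ that is part of a triangle $N\to L\to M\to N[1]$ in $\mathcal{D}$. For a full subcategory $\mathcal{X}$ of $d\text{-}\mathcal{H}$ and $s\ge1$, $\operatorname{Fac}_s(\mathcal{X})$ is the full subcategory of objects $Z_0\in d\text{-}\mathcal{H}$ for which there are extriangles $Z_i\to X_i\to Z_{i-1}$, $1\le i\le s$, with $X_1,\dots,X_s\in\mathcal{X}$. For a subcategory $\mathcal{M}$ of $d\text{-}\mathcal{H}$, $\mathcal{T}(\mathcal{M})=\{X\in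 d\text{-}\mathcal{H}\mid \mathbb{E}^i(\mathcal{M},X)=0\ \forall i>0\}$; for a $(d+1)$-term subcategory $\mathcal{S}$ of $\mathcal{K}$, likewise $\mathcal{T}(\mathcal{S})=\{X\in d\text{-}\mathcal{H}\mid\operatorname{Hom}(\mathcal{S},X[i])=0\ \forall i>0\}$. A $\mathcal{P}$-presentation of $\mathcal{M}\subseteq d\text{-}\mathcal{H}$ is a $(d+1)$-term subcategory $\mathcal{S}$ of $\mathcal{K}$ with $\operatorname{add}\{H^{[-d+1,0]}(S)\mid S\in\mathcal{S}\}=\mathcal{M}$. $\mathcal{M}$ is AIR tilting with respect to its $\mathcal{P}$-presentation $\mathcal{S}$ if $\mathcal{S}$ is contravariantly finite in $\mathcal{D}$ and $\mathcal{T}(\mathcal{S})=\operatorname{Fac}_d(\mathcal{M})$. A subcategory $\mathcal{M}$ of $d\text{-}\mathcal{H}$ is $\mathbb{E}$-universal if for any $X\in d\text{-}\mathcal{H}$ there is an extriangle $X\to Y\to M$ with $M\in\mathcal{M}$ such that for any $M'\in\mathcal{M}$ the induced map $\operatorname{Hom}(M',M)\to\mathbb{E}(M',X)$ is surjective. ''Contravariantly finite'' for $\mathcal{M}$ means contravariantly finite in $d\text{-}\mathcal{H}$. $M\in d\text{-}\mathcal{H}$ has projective dimension at most $n$ if there are extriangles $Z_i\to P_{i-1}\to Z_{i-1}$, $i>0$, with $Z_0=M$, all $P_{i-1}\in\mathcal{P}$, and $Z_n\in\mathcal{P}$. (When $\mathcal{P}\subseteq d\text{-}\mathcal{H}$,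 $\mathcal{P}$ is the class of $\mathbb{E}$-projective objects of $d\text{-}\mathcal{H}$, and $d\text{-}\mathcal{H}$ has enough projectives.) A subcategory $\mathcal{M}$ of $d\text{-}\mathcal{H}$ is tilting if: every object of $\mathcal{M}$ has projective dimension at most $d$; $\mathbb{E}^i(\mathcal{M},\mathcal{M})=0$ for all $i>0$; and for any $P\in\mathcal{P}$ there are extriangles $Y_{i-1}\to M_{i-1}\to Y_i$, $1\le i\le r$, for some $r$, with $Y_0=P$ and $M_0,\dots,M_{r-1},Y_r\in\mathcal{M}$. *)

(* Defs.v *)
From mathcomp Require Import all_boot all_order all_algebra.
From mathcomp Require Import boolp classical_sets.
Set Implicit Arguments.
Unset Strict Implicit.
Unset Printing Implicit Defensive.
Import GRing.Theory Num.Theory.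
Local Open Scope classical_set_scope.
Local Open Scope ring_scope.

Record preaddCat := PreaddCat {
  obj :> Type;
  Hom : obj -> obj -> zmodType;
  idC : forall X, Hom X X;
  compm : forall X Y Z, Hom Y Z -> Hom X Y -> Hom X Z;
  comp1m : forall X Y (f : Hom X Y), compm (idC Y) f = f;
  compm1 : forall X Y (f : Hom X Y), compm f (idC X) = f;
  compmA : forall X Y Z W (h : Hom Z W) (g : Hom Y Z) (f : Hom X Y),
    compm h (compm g f) = compm (compm h g) f;
  compDl : forall X Y Z (g g' : Hom Y Z) (f : Hom X Y),
    compm (g + g') f = compm g f + compm g' f;
  compDr : forall X Y Z (g : Hom Y Z) (f f' : Hom X Y),
    compm g (f + f') = compm g f + compm g f' }.

Arguments Hom {_} _ _.
Arguments idC {_} _.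
Arguments compm {_ _ _ _} _ _.

Notation "g ∘ f" := (compm g f) (at level 40, left associativity).

Definition is_iso (C : preaddCat) (X Y : C) (f : Hom X Y) : Prop :=
  exists g : Hom Y X, g ∘ f = idC X /\ f ∘ g = idC Y.

Definition isoc (C : preaddCat) (X Y : C) : Prop :=
  exists f : Hom X Y, is_iso f.

Definition is_zero (C : preaddCat) (Z : C) : Prop := idC Z = 0.

(* Z is a direct sum (biproduct) of X and Y *)
Definition is_biprod (C : preaddCat) (X Y Z : C) : Prop :=
  exists (iX : Hom X Z) (iY : Hom Y Z) (pX : Hom Z X) (pY : Hom Z Y),
    [/\ pX ∘ iX = idC X, pY ∘ iY = idC Y, pX ∘ iY = 0, pY ∘ iX = 0
      & iX ∘ pX + iY ∘ pY = idC Z].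

(* Z is a direct sum of the finite family F; for n = 0 this says that Z is a
   zero object *)
Definition is_dsum (C : preaddCat) (n : nat) (F : 'I_n -> C) (Z : C) : Prop :=
  exists (inj : forall j, Hom (F j) Z) (prj : forall j, Hom Z (F j)),
    [/\ forall j, prj j ∘ inj j = idC (F j),
        forall j k, j != k -> prj k ∘ inj j = 0
      & \sum_(j < n) inj j ∘ prj j = idC Z].

Definition summand (C : preaddCat) (X Z : C) : Prop :=
  exists Y : C, is_biprod X Y Z.

Record addFunctor (C D : preaddCat) := AddFunctor {
  fobj :> C -> D;
  Fmap : forall X Y, Hom X Y -> Hom (fobj X) (fobj Y);
  fmap_id : forall X, Fmap (idC X) = idC (fobj X);
  fmap_comp : forall X Y Z (g : Hom Y Z) (f : Hom X Y),
    Fmap (g ∘ f) = Fmap g ∘ Fmap f;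
  fmapD : forall X Y (f f' : Hom X Y), Fmap (f + f') = Fmap f + Fmap f' }.

(* Triangulated categories (Verdier's axioms).  The shift is an autoequivalence
   with a chosen quasi-inverse [ush]; the strict case, where the shift is an
   automorphism, is the one where the components of [unit_sh] and [counit_sh]
   are identities. *)
Record triCat := TriCat {
  tri_base :> preaddCat;
  has_zero : exists Z : tri_base, is_zero Z;
  has_biprod : forall X Y : tri_base, exists Z, is_biprod X Y Z;
  sh : addFunctor tri_base tri_base;
  ush : addFunctor tri_base tri_base;
  unit_sh : forall X, Hom X (ush (sh X));
  unit_sh_iso : forall X, is_iso (unit_sh X);
  unit_sh_nat : forall X Y (f : Hom X Y),
    unit_sh Y ∘ f = Fmap ush (Fmap sh f) ∘ unit_sh X;
  counit_sh : forall X, Hom (sh (ush X)) X;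
  counit_sh_iso : forall X, is_iso (counit_sh X);
  counit_sh_nat : forall X Y (f : Hom X Y),
    counit_sh Y ∘ Fmap sh (Fmap ush f) = f ∘ counit_sh X;
  (* [tri f g h]: X -f-> Y -g-> Z -h-> X[1] is a (distinguished) triangle *)
  tri : forall X Y Z, Hom X Y -> Hom Y Z -> Hom Z (sh X) -> Prop;
  tri_iso : forall X Y Z X' Y' Z'
      (f : Hom X Y) (g : Hom Y Z) (h : Hom Z (sh X))
      (f' : Hom X' Y') (g' : Hom Y' Z') (h' : Hom Z' (sh X'))
      (a : Hom X X') (b : Hom Y Y') (c : Hom Z Z'),
    is_iso a -> is_iso b -> is_iso c ->
    b ∘ f = f' ∘ a -> c ∘ g = g' ∘ b -> Fmap sh a ∘ h = h' ∘ c ->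
    tri f g h -> tri f' g' h';
  tri_id : forall X Z, is_zero Z -> tri (idC X) (0 : Hom X Z) 0;
  tri_ex : forall X Y (f : Hom X Y),
    exists Z (g : Hom Y Z) (h : Hom Z (sh X)), tri f g h;
  tri_rot : forall X Y Z (f : Hom X Y) (g : Hom Y Z) (h : Hom Z (sh X)),
    tri f g h <-> tri g h (- Fmap sh f);
  tri_mor : forall X Y Z X' Y' Z'
      (f : Hom X Y) (g : Hom Y Z) (h : Hom Z (sh X))
      (f' : Hom X' Y') (g' : Hom Y' Z') (h' : Hom Z' (sh X'))
      (a : Hom X X') (b : Hom Y Y'),
    tri f g h -> tri f' g' h' -> b ∘ f = f' ∘ a ->
    exists c : Hom Z Z', c ∘ g = g' ∘ b /\ Fmap sh a ∘ h = h' ∘ c;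
  tri_oct : forall X Y Z U V W (f : Hom X Y) (g : Hom Y Z)
      (u : Hom Y U) (u' : Hom U (sh X))
      (v : Hom Z V) (v' : Hom V (sh Y))
      (w : Hom Z W) (w' : Hom W (sh X)),
    tri f u u' -> tri g v v' -> tri (g ∘ f) w w' ->
    exists (a : Hom U W) (b : Hom W V),
      [/\ tri a b (Fmap sh u ∘ v'),
          a ∘ u = w ∘ g, w' ∘ a = u', b ∘ w = v
        & v' ∘ b = Fmap sh f ∘ w'] }.

Arguments sh {_}.
Arguments ush {_}.
Arguments tri {_ _ _ _} _ _ _.

Definition shiftz (D : triCat) (X : D) (i : int) : D :=
  match i with
  | Posz n => iter n sh X
  | Negz n => iter n.+1 ush X
  end.

Notation "X ⟦ i ⟧" := (shiftz X i%R) (at level 2, format "X ⟦ i ⟧").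

(* Full subcategories are given by their sets of objects. *)

Definition addc (D : triCat) (X : set D) : set D :=
  [set Y | exists (n : nat) (F : 'I_n -> D) (Z : D),
     [/\ forall j, X (F j), is_dsum F Z & summand Y Z]].

Definition subcat (D : triCat) (X : set D) : Prop := X = addc X.

Definition Hom0 (D : triCat) (X Y : set D) : Prop :=
  forall A B, X A -> Y B -> forall f : Hom A B, f = 0.

Definition shiftc (D : triCat) (X : set D) (i : int) : set D :=
  [set Y | exists2 A, X A & isoc Y A⟦i⟧].

Definition right_approx (D : triCat) (X : set D) (A Y : D) (f : Hom A Y) :=
  X A /\ forall A' (g : Hom A' Y), X A' -> exists h : Hom A' A, g = f ∘ h.

Definition contrafinite (D : triCat) (X C : set D) : Prop :=
  forall Y, C Y -> exists (A : D) (f : Hom A Y), right_approx X f.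

Definition presilting (D : triCat) (P : set D) : Prop :=
  subcat P /\ forall i : int, 0 < i -> Hom0 P (shiftc P i).

Definition starc (D : triCat) (X Y : set D) : set D :=
  [set Z | exists (A B : D) (f : Hom A Z) (g : Hom Z B) (h : Hom B (sh A)),
     [/\ X A, Y B & tri f g h]].

(* P * P[1] * ... * P[n], bracketed to the left; [starc] is associative by the
   octahedral axiom *)
Fixpoint Pint (D : triCat) (P : set D) (n : nat) : set D :=
  if n is k.+1 then starc (Pint P k) (shiftc P k.+1) else P.

Definition thick_subcat (D : triCat) (U : set D) : Prop :=
  [/\ subcat U, (forall X, U X -> U (sh X)), (forall X, U X -> U (ush X))
    & forall X Y Z (f : Hom X Y) (g : Hom Y Z) (h : Hom Z (sh X)),
        tri f g h -> U X -> U Y -> U Z].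

Definition thick (D : triCat) (P : set D) : set D :=
  [set X | forall U : set D, thick_subcat U -> P `<=` U -> U X].

Definition Dle0 (D : triCat) (P : set D) : set D :=
  [set Y | forall i : int, 0 < i -> Hom0 P [set Y⟦i⟧]].
Definition Dge0 (D : triCat) (P : set D) : set D :=
  [set Y | forall i : int, i < 0 -> Hom0 P [set Y⟦i⟧]].
Definition Dle (D : triCat) (P : set D) (q : int) : set D := shiftc (Dle0 P) (- q).
Definition Dge (D : triCat) (P : set D) (q : int) : set D := shiftc (Dge0 P) (- q).
Definition Dint (D : triCat) (P : set D) (p q : int) : set D :=
  Dle P q `&` Dge P p.

Definition t_structure (D : triCat) (A B : set D) : Prop :=
  [/\ subcat A /\ subcat B,
      A `<=` shiftc A (-1), shiftc B (-1) `<=` B,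
      Hom0 A (shiftc B (-1))
    & starc A (shiftc B (-1)) = setT].

Definition non_degenerate (D : triCat) (A B : set D) : Prop :=
  (forall X : D, (forall n : int, shiftc A n X) -> is_zero X) /\
  (forall X : D, (forall n : int, shiftc B n X) -> is_zero X).

(* The truncations of an object are only determined up to isomorphism, so
   they are relations here: [trunc_le P q X A] says that A is (isomorphic to)
   the truncation of X in D^{<= q}, and similarly for the other two. *)
Definition trunc_le (D : triCat) (P : set D) (q : int) (X A : D) : Prop :=
  exists (B : D) (f : Hom A X) (g : Hom X B) (h : Hom B (sh A)),
    [/\ Dle P q A, Dge P (q + 1) B & tri f g h].
Definition trunc_ge (D : triCat) (P : set D) (p : int) (X B : D) : Prop :=
  exists (A : D) (f : Hom A X) (g : Hom X B) (h : Hom B (sh A)),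
    [/\ Dle P (p - 1) A, Dge P p B & tri f g h].
Definition Htrunc (D : triCat) (P : set D) (p q : int) (X Y : D) : Prop :=
  exists2 A, trunc_le P q X A & trunc_ge P p A Y.

Definition dH (D : triCat) (P : set D) (d : nat) : set D :=
  Dint P (- d%:Z + 1) 0.

Definition extriangle (D : triCat) (P : set D) (d : nat) (N L M : D) : Prop :=
  [/\ dH P d N, dH P d L, dH P d M &
    exists (f : Hom N L) (g : Hom L M) (h : Hom M (sh N)), tri f g h].

Definition Fac (D : triCat) (P : set D) (d s : nat) (X : set D) : set D :=
  [set Z0 | dH P d Z0 /\ exists Z W : nat -> D,
     Z 0%N = Z0 /\
     forall i, (1 <= i <= s)%N -> X (W i) /\ extriangle P d (Z i) (W i) (Z i.-1)].

(* the class T(S), for S contained in d-H or in thick(P) *)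
Definition Tperp (D : triCat) (P : set D) (d : nat) (S : set D) : set D :=
  [set X | dH P d X /\ forall i : int, 0 < i -> Hom0 S [set X⟦i⟧]].

Definition term_subcat (D : triCat) (P : set D) (d : nat) (S : set D) : Prop :=
  [/\ subcat S, S `<=` thick P & S `<=` Pint P d].

Definition subcat_dH (D : triCat) (P : set D) (d : nat) (M : set D) : Prop :=
  subcat M /\ M `<=` dH P d.

Definition P_presentation (D : triCat) (P : set D) (d : nat) (M S : set D) : Prop :=
  term_subcat P d S /\
  addc [set Y | exists2 X, S X & Htrunc P (- d%:Z + 1) 0 X Y] = M.

(* to be used when S is a P-presentation of M *)
Definition AIR_tilting (D : triCat) (P : set D) (d : nat) (M S : set D) : Prop :=
  contrafinite S setT /\ Tperp P d S = Fac P d d M.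

Definition E_universal (D : triCat) (P : set D) (d : nat) (M : set D) : Prop :=
  forall X, dH P d X ->
  exists (Y M0 : D) (f : Hom X Y) (g : Hom Y M0) (h : Hom M0 (sh X)),
    [/\ dH P d Y, M M0, tri f g h
      & forall M', M M' -> forall e : Hom M' (sh X),
          exists u : Hom M' M0, h ∘ u = e].

Definition projdim_le (D : triCat) (P : set D) (d n : nat) (M0 : D) : Prop :=
  exists Z Q : nat -> D,
    [/\ Z 0%N = M0, P (Z n)
      & forall i, (0 < i)%N ->
          P (Q i.-1) /\ extriangle P d (Z i) (Q i.-1) (Z i.-1)].

Definition tilting (D : triCat) (P : set D) (d : nat) (M : set D) : Prop :=
  [/\ forall X, M X -> projdim_le P d d X,
      forall i : int, 0 < i -> Hom0 M (shiftc M i)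
    & forall P0, P P0 -> exists (r : nat) (Y N : nat -> D),
        [/\ Y 0%N = P0, M (Y r)
          & forall i, (1 <= i <= r)%N ->
              M (N i.-1) /\ extriangle P d (Y i.-1) (N i.-1) (Y i)]].

(* Main.v *)
(** Write W for the class of objects U of D^{<=0} with Hom(M, U[i]) = 0 for all
    i > 0.  One principle is used twice: if every object U of a class W has a
    triangle U' -> S_0 -> U with S_0 in S and U' in W, if Hom(S, W[i]) = 0 for
    i > 0, and if Hom(U, W[n+1]) = 0, then U lies in S * S[1] * ... * S[n].  For
    S = P and W = D^{<=0} it identifies P^{[0,d]} with projective dimension at
    most d.  For S = M and W as above it shows that (4) puts P[d] in
    M * M[1] * ... * M[d]; shifting back by d and peeling off the layers gives
    the M-coresolution of P required in (1).

    Hom(M, -) kills D^{<= -d-1} when M is contained in P^{[0,d]}, so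
    M-approximations in D are built from the truncations at 0, -d and -d-1;
    the only nontrivial pieces lie in d-H and in (d-H)[1], where they exist by
    contravariant finiteness and E-universality.

    (1), (2) and (3) each give (4): every map from P to an object X of T(M)
    factors through M, so the cocone of a right M-approximation of X stays in
    d-H and in T(M). *)

From mathcomp Require Import all_boot all_order all_algebra.
From mathcomp Require Import boolp classical_sets.
From mathcomp Require Import zify.
Require Import Defs.
Set Implicit Arguments.
Unset Strict Implicit.
Unset Printing Implicit Defensive.
Import GRing.Theory Num.Theory.
Local Open Scope classical_set_scope.
Local Open Scope ring_scope.

(** * Zero morphisms, signs and isomorphisms in preadditive categories *)

Section Preadditive.
Variable C : preaddCat.
Implicit Types X Y Z W A B : C.

Lemma comp0m X Y Z (f : Hom X Y) : (0 : Hom Y Z) ∘ f = 0.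
Proof. by apply: (addrI (0 ∘ f)); rewrite -compDl !addr0. Qed.

Lemma compm0 X Y Z (g : Hom Y Z) : g ∘ (0 : Hom X Y) = 0.
Proof. by apply: (addrI (g ∘ 0)); rewrite -compDr !addr0. Qed.

Lemma compNm X Y Z (g : Hom Y Z) (f : Hom X Y) : (- g) ∘ f = - (g ∘ f).
Proof. by apply: (addrI (g ∘ f)); rewrite -compDl !subrr comp0m. Qed.

Lemma compmN X Y Z (g : Hom Y Z) (f : Hom X Y) : g ∘ (- f) = - (g ∘ f).
Proof. by apply: (addrI (g ∘ f)); rewrite -compDr !subrr compm0. Qed.

Lemma is_iso_id X : is_iso (idC X).
Proof. by exists (idC X); rewrite comp1m. Qed.

Lemma isoc_refl X : isoc X X.
Proof. by exists (idC X); apply: is_iso_id. Qed.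

Lemma isoc_sym X Y : isoc X Y -> isoc Y X.
Proof. by move=> [f [g [gf fg]]]; exists g, f. Qed.

Lemma isoc_trans X Y Z : isoc X Y -> isoc Y Z -> isoc X Z.
Proof.
move=> [f [g [gf fg]]] [f' [g' [gf' fg']]]; exists (f' ∘ f), (g ∘ g'); split.
  by rewrite -compmA (compmA g') gf' comp1m.
by rewrite -compmA (compmA f) fg comp1m.
Qed.

Definition orth A B : Prop := forall f : Hom A B, f = 0.

Lemma orth_iso A A' B B' : isoc A A' -> isoc B B' -> orth A B -> orth A' B'.
Proof.
move=> [a [a' [_ aa']]] [b [b' [_ bb']]] AB f.
by rewrite -[f]compm1 -aa' -[f]comp1m -bb' -!compmA (compmA f) (compmA b')
           (AB (b' ∘ _)) comp0m compm0.
Qed.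

Lemma is_zero_orthl Z A : is_zero Z -> orth Z A.
Proof. by move=> Z0 f; rewrite -[f]compm1 Z0 compm0. Qed.

Lemma is_zero_orthr Z A : is_zero Z -> orth A Z.
Proof. by move=> Z0 f; rewrite -[f]comp1m Z0 comp0m. Qed.

Lemma biprod_zero X Y Z : isoc X Z -> is_zero Y -> is_biprod X Y Z.
Proof.
move=> [f [g [gf fg]]] Y0; exists f, 0, g, 0; split => //;
  rewrite ?compm0 ?comp0m ?addr0 //; exact/esym.
Qed.

End Preadditive.

Lemma Fmap0 (C D : preaddCat) (F : addFunctor C D) (X Y : C) :
  Fmap F (0 : Hom X Y) = 0.
Proof. by apply: (addrI (Fmap F (0 : Hom X Y))); rewrite -fmapD !addr0. Qed.

Lemma FmapN (C D : preaddCat) (F : addFunctor C D) (X Y : C) (f : Hom X Y) :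
  Fmap F (- f) = - Fmap F f.
Proof. by apply: (addrI (Fmap F f)); rewrite -fmapD !subrr Fmap0. Qed.

Lemma Fmap_isoc (C D : preaddCat) (F : addFunctor C D) (X Y : C) :
  isoc X Y -> isoc (F X) (F Y).
Proof.
move=> [f [g [gf fg]]]; exists (Fmap F f), (Fmap F g).
by rewrite -!fmap_comp gf fg !fmap_id.
Qed.

(** * Integer shifts through an autoequivalence and its quasi-inverse *)

Section Shift.
Variable D : triCat.
Implicit Types X Y Z W A B : D.

Lemma ush_sh X : isoc (ush (sh X)) X.
Proof. by apply: isoc_sym; exists (unit_sh X); apply: unit_sh_iso. Qed.

Lemma sh_ush X : isoc (sh (ush X)) X.
Proof. by exists (counit_sh X); apply: counit_sh_iso. Qed.

Lemma sh_inj X Y (f g : Hom X Y) : Fmap sh f = Fmap sh g -> f = g.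
Proof.
move=> fg; have [u [uu _]] := unit_sh_iso Y.
by rewrite -[f]comp1m -[g]comp1m -uu -!compmA !unit_sh_nat fg.
Qed.

Lemma ush_inj X Y (f g : Hom X Y) : Fmap ush f = Fmap ush g -> f = g.
Proof.
move=> fg; have [u [_ uu]] := counit_sh_iso X.
by rewrite -[f]compm1 -[g]compm1 -uu !compmA -!counit_sh_nat fg.
Qed.

(** Transporting [g] back through the unit gives the candidate; after applying the faithful functor
    [ush], naturality of the unit identifies its image with [g]. *)
Lemma sh_full X Y (g : Hom (sh X) (sh Y)) : exists f : Hom X Y, Fmap sh f = g.
Proof.
have [u [uu uu']] := unit_sh_iso Y; have [v [vv vv']] := unit_sh_iso X.
exists (u ∘ Fmap ush g ∘ unit_sh X); apply: ush_inj.
rewrite -[LHS]compm1 -vv' compmA -unit_sh_nat !compmA uu' comp1m.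
by rewrite -compmA vv' compm1.
Qed.

Lemma orth_sh A B : orth (sh A) (sh B) <-> orth A B.
Proof.
split=> AB f; first by apply: sh_inj; rewrite Fmap0.
by have [g <-] := sh_full f; rewrite (AB g) Fmap0.
Qed.

Lemma orth_ush A B : orth (ush A) (ush B) <-> orth A B.
Proof.
rewrite -orth_sh.
by split; apply: orth_iso; do [exact: sh_ush | exact/isoc_sym/sh_ush].
Qed.

Lemma orth_shz i A B : orth A⟦i⟧ B⟦i⟧ <-> orth A B.
Proof.
case: i => n; first by elim: n => //= n IH; rewrite orth_sh.
by elim: n => [|n IH]; rewrite /= orth_ush.
Qed.

Lemma isoc_shz i X Y : isoc X Y -> isoc X⟦i⟧ Y⟦i⟧.
Proof.
move=> XY; case: i => n /=; first by elim: n => //= n IH; apply: Fmap_isoc.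
by elim: n => [|n IH] /=; apply: Fmap_isoc.
Qed.

Lemma shz_succ i X : isoc X⟦i + 1⟧ (sh X⟦i⟧).
Proof.
case: i => [n|[|n]].
- by rewrite -PoszD addn1; apply: isoc_refl.
- exact/isoc_sym/sh_ush.
- have -> : Negz n.+1 + 1 = Negz n by lia.
  exact/isoc_sym/sh_ush.
Qed.

Lemma shz_pred i X : isoc X⟦i - 1⟧ (ush X⟦i⟧).
Proof.
have := Fmap_isoc ush (shz_succ (i - 1) X); rewrite subrK => e.
exact/isoc_sym/(isoc_trans e)/ush_sh.
Qed.

Lemma shz_add i j X : isoc X⟦i⟧⟦j⟧ X⟦i + j⟧.
Proof.
elim/int_rec: j => [|n IH|n IH].
- by rewrite addr0; apply: isoc_refl.
- rewrite intS (addrC 1) addrA.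
  apply: isoc_trans (isoc_sym (shz_succ _ _)).
  apply: isoc_trans (shz_succ _ _) _; exact: Fmap_isoc.
- rewrite intS opprD (addrC (- 1)) addrA.
  apply: isoc_trans (isoc_sym (shz_pred _ _)).
  apply: isoc_trans (shz_pred _ _) _; exact: Fmap_isoc.
Qed.

Lemma orth_shz_sub i j A B : orth A⟦i⟧ B⟦j⟧ <-> orth A B⟦j - i⟧.
Proof.
rewrite -(orth_shz i A B⟦_⟧); split; apply: orth_iso; try exact: isoc_refl.
  by apply: isoc_sym; have := shz_add (j - i) i B; rewrite subrK.
by have := shz_add (j - i) i B; rewrite subrK.
Qed.

Lemma orth_shzD i j A B : orth A B⟦i⟧⟦j⟧ <-> orth A B⟦i + j⟧.
Proof.
split; apply: orth_iso; try exact: isoc_refl; first exact: shz_add.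
exact/isoc_sym/shz_add.
Qed.

Lemma is_zero_sh Z : is_zero Z -> is_zero (sh Z).
Proof. by rewrite /is_zero -fmap_id => ->; rewrite Fmap0. Qed.

End Shift.

(** * Exactness, rotation and splitting of triangles *)

Section Triangles.
Variable D : triCat.
Implicit Types X Y Z W A B : D.

Lemma tri_comp X Y Z (f : Hom X Y) (g : Hom Y Z) (h : Hom Z (sh X)) :
  tri f g h -> g ∘ f = 0.
Proof.
move=> t; have [O O0] := has_zero D.
have [|c [e _]] := tri_mor (a := idC X) (b := f) (tri_id X O0) t => //.
by rewrite -e compm0.
Qed.

(** Exactness of Hom(A, -) at Y: the rotated trivial triangle on A maps to the rotated triangle, and
    fullness of the shift turns the third component into a map A -> X. *)
Lemma tri_wker X Y Z (f : Hom X Y) (g : Hom Y Z) (h : Hom Z (sh X)) A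
    (u : Hom A Y) : tri f g h -> g ∘ u = 0 -> exists v, u = f ∘ v.
Proof.
move=> t gu; have [O O0] := has_zero D.
have tA := (tri_rot _ _ _).1 (tri_id A O0).
have [|c [_]] := tri_mor (a := u) (b := (0 : Hom O Z)) tA ((tri_rot _ _ _).1 t).
  by rewrite gu comp0m.
rewrite fmap_id compmN compm1 compNm => /oppr_inj.
have [v <-] := sh_full c; rewrite -fmap_comp => /sh_inj e.
by exists v.
Qed.

Lemma tri_wcoker X Y Z (f : Hom X Y) (g : Hom Y Z) (h : Hom Z (sh X)) A
    (u : Hom Y A) : tri f g h -> u ∘ f = 0 -> exists v, u = v ∘ g.
Proof.
move=> t uf; have [O O0] := has_zero D.
have tA : tri (0 : Hom O A) (idC A) 0.
  by apply/tri_rot; rewrite Fmap0 oppr0; apply/tri_id/is_zero_sh.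
have [|c [e _]] := tri_mor (a := (0 : Hom X O)) (b := u) t tA.
  by rewrite uf comp0m.
by exists c; rewrite e comp1m.
Qed.

(** Forgetting the morphisms makes the notion invariant under isomorphism, so rotations and shifts
    compose without tracking signs, units or counits. *)
Definition triangle X Y Z : Prop :=
  exists (f : Hom X Y) (g : Hom Y Z) (h : Hom Z (sh X)), tri f g h.

Lemma triangle_iso X Y Z X' Y' Z' : isoc X X' -> isoc Y Y' -> isoc Z Z' ->
  triangle X Y Z -> triangle X' Y' Z'.
Proof.
move=> [a ia] [b ib] [c ic] [f [g [h t]]].
have [a' [aa aa']] := ia; have [b' [bb bb']] := ib; have [c' [cc cc']] := ic.
exists (b ∘ f ∘ a'), (c ∘ g ∘ b'), (Fmap sh a ∘ h ∘ c').
apply: tri_iso ia ib ic _ _ _ t; first by rewrite -compmA aa compm1.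
  by rewrite -compmA bb compm1.
by rewrite -compmA cc compm1.
Qed.

Lemma triangle_rot X Y Z : triangle X Y Z -> triangle Y Z (sh X).
Proof. by move=> [f [g [h /tri_rot t]]]; exists g, h, (- Fmap sh f). Qed.

(** Here [f] is kept literally, so that a chosen approximation remains a map of the rotated
    triangle; only [Z] is replaced by [sh (ush Z)], along the counit. *)
Lemma tri_irot X Y Z (f : Hom X Y) (g : Hom Y Z) (h : Hom Z (sh X)) :
  tri f g h ->
  exists (h' : Hom (ush Z) X) (k : Hom Y (sh (ush Z))), tri h' f k.
Proof.
move=> t; have [c [cc cc']] := counit_sh_iso Z.
have [h' e] := sh_full (h ∘ counit_sh Z).
exists (- h'), (c ∘ g); apply/tri_rot; rewrite FmapN opprK e.
apply: tri_iso (is_iso_id _) (is_iso_id _) _ _ _ _ t.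
- by exists (counit_sh Z); split; [exact: cc'|exact: cc].
- by rewrite comp1m compm1.
- by rewrite compm1.
- by rewrite fmap_id comp1m -compmA cc' compm1.
Qed.

Lemma triangle_irot X Y Z : triangle X Y Z -> triangle (ush Z) X Y.
Proof. by move=> [f [g [h /tri_irot[h' [k t]]]]]; exists h', f, k. Qed.

Lemma triangle_shz i X Y Z : triangle X Y Z -> triangle X⟦i⟧ Y⟦i⟧ Z⟦i⟧.
Proof.
move=> t; case: i => n; first by elim: n => //= n IH; do 3!apply: triangle_rot.
by elim: n => [|n IH] /=; do 3!apply: triangle_irot.
Qed.

Lemma orth_triangler A X Y Z :
  triangle X Y Z -> orth A X -> orth A Z -> orth A Y.
Proof.
move=> [f [g [h t]]] AX AZ u; have [v ->] := tri_wker t (AZ (g ∘ u)).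
by rewrite (AX v) compm0.
Qed.

Lemma orth_trianglel A X Y Z :
  triangle X Y Z -> orth X A -> orth Z A -> orth Y A.
Proof.
move=> [f [g [h t]]] XA ZA u; have [v ->] := tri_wcoker t (XA (u ∘ f)).
by rewrite (ZA v) comp0m.
Qed.

(** Dimension shifting: Hom(X, A[i]) sits between Hom(Y, A[i]) and Hom(Z, A[i+1]) in the long exact
    sequence. *)
Lemma orth_trianglel1 A X Y Z i :
  triangle X Y Z -> orth Y A⟦i⟧ -> orth Z A⟦i + 1⟧ -> orth X A⟦i⟧.
Proof.
move=> /triangle_irot t YA ZA; apply: orth_trianglel t _ YA.
apply/orth_sh; apply: orth_iso (isoc_sym (sh_ush Z)) (shz_succ _ _) ZA.
Qed.

Lemma triangle_zerol X Y Z : triangle X Y Z -> is_zero X -> isoc Y Z.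
Proof.
move=> [f [g [h t]]] X0.
have [r /esym rg] := tri_wcoker (u := idC Y) t (is_zero_orthl X0 _).
exists g, r; split=> //.
have [s gs] := tri_wker (u := idC Z) ((tri_rot _ _ _).1 t)
  (is_zero_orthr (is_zero_sh X0) _).
by have -> : r = s by rewrite -[s]comp1m -rg -compmA -gs compm1.
Qed.

Lemma triangle_zeror X Y Z : triangle X Y Z -> is_zero Z -> isoc X Y.
Proof.
move=> /triangle_irot t Z0; apply: triangle_zerol t _.
by rewrite /is_zero -fmap_id Z0 Fmap0.
Qed.

Lemma triangle_id X Z : is_zero Z -> triangle X X Z.
Proof. by move=> /(tri_id X) t; exists (idC X), 0, 0. Qed.

Lemma triangle_0id X Z : is_zero Z -> triangle Z X X.
Proof.
move=> Z0; apply: triangle_iso (ush_sh Z) (isoc_refl _) (isoc_refl _) _.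
exact/triangle_irot/triangle_id/is_zero_sh.
Qed.

(** With h = 0 the map f is a monomorphism and g has a section s; then 1 - s g factors through f,
    and the factor is the projection to X. *)
Lemma summand_split X Y Z (f : Hom X Y) (g : Hom Y Z) (h : Hom Z (sh X)) :
  tri f g h -> h = 0 -> summand Z Y.
Proof.
move=> t h0; have t1 := (tri_rot _ _ _).1 t.
have f_mono A (x : Hom A X) : f ∘ x = 0 -> x = 0.
  move=> fx; apply: sh_inj; rewrite Fmap0.
  have [|y ->] := tri_wker (u := Fmap sh x) ((tri_rot _ _ _).1 t1).
    by rewrite compNm -fmap_comp fx Fmap0 oppr0.
  by rewrite h0 comp0m.
have [|s /esym gs] := tri_wker (u := idC Z) t1; first by rewrite h0 comp0m.
have [|r fr] := tri_wker (u := idC Y - s ∘ g) t.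
  by rewrite compDr compm1 compmN compmA gs comp1m subrr.
have gf := tri_comp t.
exists X, s, f, g, r; split=> //; last by rewrite -fr addrC subrK.
  apply/subr0_eq/f_mono; rewrite compDr compmA -fr compDl comp1m !compNm.
  by rewrite -compmA gf compm0 oppr0 addr0 compmN compm1 subrr.
by apply: f_mono; rewrite compmA -fr compDl comp1m compNm -compmA gs compm1 subrr.
Qed.

Lemma starc_triangle (S T : set D) Z :
  starc S T Z <-> exists A B, [/\ S A, T B & triangle A Z B].
Proof.
split=> [[A [B [f [g [h [SA TB t]]]]]]|[A [B [SA TB [f [g [h t]]]]]]].
  by exists A, B; split=> //; exists f, g, h.
by exists A, B, f, g, h.
Qed.

(** Associativity of [starc]: F is the cocone of the composite W -> B' -> C, and the octahedral
    axiom for this composite places it between A and B. *)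
Lemma triangle_assoc A W B' B C : triangle A W B' -> triangle B B' C ->
  exists F, triangle A F B /\ triangle F W C.
Proof.
move=> /triangle_rot[f [a [a' ta]]] /triangle_rot[g [b [b' tb]]].
have [V [w [w' tw]]] := tri_ex (g ∘ f).
have [x [y [txy _ _ _ _]]] := tri_oct ta tb tw.
exists (ush V); split.
  apply: triangle_iso (ush_sh A) (isoc_refl _) (ush_sh B) _.
  by do 3!apply: triangle_irot; exists x, y, (Fmap sh a ∘ b').
by apply: triangle_irot; exists (g ∘ f), w, w'.
Qed.

End Triangles.

(** * Closure properties of full subcategories equal to their additive closure *)

Section Subcategories.
Variables (D : triCat) (S : set D).
Hypothesis S_sub : subcat S.
Implicit Types X Y Z A B : D.

Lemma dsum1 X Z : isoc X Z -> is_dsum (fun _ : 'I_1 => X) Z.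
Proof.
move=> [f [g [gf fg]]]; exists (fun=> f), (fun=> g); split=> //.
  by move=> j k; rewrite !ord1 eqxx.
by rewrite big_ord_recl big_ord0 addr0.
Qed.

Lemma subcat_summand Y Z : S Z -> summand Y Z -> S Y.
Proof.
move=> SZ YZ; rewrite S_sub; exists 1%N, (fun=> Z), Z; split=> //.
exact/dsum1/isoc_refl.
Qed.

Lemma subcat_iso Y Z : isoc Y Z -> S Z -> S Y.
Proof.
move=> YZ SZ; apply: subcat_summand SZ _; have [O O0] := has_zero D.
by exists O; apply: biprod_zero.
Qed.

Lemma subcat_zero Z : is_zero Z -> S Z.
Proof.
move=> Z0; rewrite S_sub; exists 0%N, (fun=> Z), Z; split; first by case.
  exists (fun=> 0), (fun=> 0); split; [by case | by case |].
  by rewrite big_ord0; exact/esym.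
by exists Z; apply: biprod_zero => //; apply: isoc_refl.
Qed.

Lemma subcat_biprod X Y Z : is_biprod X Y Z -> S X -> S Y -> S Z.
Proof.
move=> [iX [iY [pX [pY [pi1 pi2 pi3 pi4 e]]]]] SX SY.
(* The two-element family is indexed through booleans so that the dependent injections and
   projections are defined by case analysis. *)
pose F (b : bool) := if b then Y else X.
pose inj b : Hom (F b) Z := if b as b return Hom (F b) Z then iY else iX.
pose prj b : Hom Z (F b) := if b as b return Hom Z (F b) then pY else pX.
pose c (j : 'I_2) := j != ord0.
rewrite S_sub; exists 2%N, (fun j => F (c j)), Z; split.
- by move=> j; case: (c j).
- exists (fun j => inj (c j)), (fun j => prj (c j)); split.
  + by move=> j; case: (c j).
  + move=> j k jk; have : c j != c k.
      by rewrite /c; case: j jk => -[|[|//]] ?; case: k => -[|[|//]] ?.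
    by case: (c j); case: (c k).
  + by rewrite !big_ord_recl big_ord0 addr0.
- have [O O0] := has_zero D.
  by exists O; apply: biprod_zero => //; apply: isoc_refl.
Qed.

End Subcategories.

(** * Vanishing of Hom from a class in a range of degrees *)

Section Vanishing.
Variables (D : triCat) (S : set D).
Implicit Types (X Y Z A B : D) (q i : int).

(** For S = P this is D^{<=q}, and [ge] is D^{>=q}; for S = M, [le M 0] is the vanishing condition
    that cuts out T(M). *)
Definition le q X := forall i, q < i -> forall A, S A -> orth A X⟦i⟧.
Definition ge q X := forall i, i < q -> forall A, S A -> orth A X⟦i⟧.

Lemma le_iso q X Y : isoc X Y -> le q X -> le q Y.
Proof.
move=> XY lX i qi A SA; apply: orth_iso (isoc_refl _) (isoc_shz i XY) _.
exact: lX.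
Qed.

Lemma ge_iso q X Y : isoc X Y -> ge q X -> ge q Y.
Proof.
move=> XY lX i qi A SA; apply: orth_iso (isoc_refl _) (isoc_shz i XY) _.
exact: lX.
Qed.

Lemma le_mono q q' X : q <= q' -> le q X -> le q' X.
Proof. by move=> qq' lX i qi; apply: lX; lia. Qed.

Lemma ge_mono q q' X : q' <= q -> ge q X -> ge q' X.
Proof. by move=> qq' lX i qi; apply: lX; lia. Qed.

Lemma le_shz q i X : le q X⟦i⟧ <-> le (q + i) X.
Proof.
split=> lX j qj A SA; last by apply/orth_shzD/lX => //; lia.
by rewrite -(subrK i j) addrC -orth_shzD; apply: lX => //; lia.
Qed.

Lemma ge_shz q i X : ge q X⟦i⟧ <-> ge (q + i) X.
Proof.
split=> lX j qj A SA; last by apply/orth_shzD/lX => //; lia.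
by rewrite -(subrK i j) addrC -orth_shzD; apply: lX => //; lia.
Qed.

Lemma le_zero q Z : is_zero Z -> le q Z.
Proof.
move=> Z0 i _ A _.
have /(orth_shz_sub (- i) 0) := @is_zero_orthr _ Z A⟦-i⟧ Z0.
by rewrite sub0r opprK.
Qed.

Lemma ge_zero q Z : is_zero Z -> ge q Z.
Proof.
move=> Z0 i _ A _.
have /(orth_shz_sub (- i) 0) := @is_zero_orthr _ Z A⟦-i⟧ Z0.
by rewrite sub0r opprK.
Qed.

Lemma le_ext q X Y Z : triangle X Y Z -> le q X -> le q Z -> le q Y.
Proof.
move=> t lX lZ i qi A SA.
by apply: orth_triangler (triangle_shz i t) _ _; [apply: lX|apply: lZ].
Qed.

Lemma ge_ext q X Y Z : triangle X Y Z -> ge q X -> ge q Z -> ge q Y.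
Proof.
move=> t lX lZ i qi A SA.
by apply: orth_triangler (triangle_shz i t) _ _; [apply: lX|apply: lZ].
Qed.

Lemma le_cone q X Y Z : triangle X Y Z -> le (q + 1) X -> le q Y -> le q Z.
Proof. by move=> /triangle_rot t /le_shz lX lY; apply: le_ext t lY lX. Qed.

Lemma ge_cocone q X Y Z : triangle X Y Z -> ge q Y -> ge (q - 1) Z -> ge q X.
Proof.
by move=> /triangle_irot t lY lZ; apply: ge_ext t _ lY; apply/(ge_shz _ (-1)).
Qed.

(** For i >= 2, Hom(A, X[i]) lies between Hom(A, Z[i-1]) and Hom(A, Y[i]). In degree 1 every map A
    -> X[1] comes from Z, hence by surjectivity from Y, and so vanishes. *)
Lemma le_cocone X Y Z (f : Hom X Y) (g : Hom Y Z) (h : Hom Z (sh X)) :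
  tri f g h -> le 0 Y -> le 0 Z ->
  (forall A, S A -> forall u : Hom A Z, exists v, u = g ∘ v) ->
  le 0 X.
Proof.
move=> t lY lZ surj i i0 A SA.
have [->|i1] := eqVneq i 1; last first.
  rewrite -(subrK 1 i) addrC -orth_shzD; move: t => /tri_rot t.
  have t' : triangle Z (sh X) (sh Y).
    by apply: triangle_rot; exists g, h, (- Fmap sh f).
  apply: orth_triangler (triangle_shz (i - 1) t') _ _.
    by apply: lZ => //; lia.
  by apply/(orth_shzD 1); apply: lY => //; lia.
move=> u /=; have t1 := (tri_rot _ _ _).1 t.
have [|v ->] := tri_wker (u := u) ((tri_rot _ _ _).1 t1).
  exact: (lY 1 _ A SA).
have [w ->] := surj A SA v.
by rewrite compmA (tri_comp t1) comp0m.
Qed.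

(** The obstruction to lifting [u] lies in Hom(A, X[1]). *)
Lemma le_cocone_surj X Y Z (f : Hom X Y) (g : Hom Y Z) (h : Hom Z (sh X)) A
    (u : Hom A Z) : tri f g h -> le 0 X -> S A -> exists v, u = g ∘ v.
Proof.
move=> /tri_rot t lX SA; apply: tri_wker t _; exact: (lX 1 _ A SA).
Qed.

End Vanishing.

(** * Truncations for the t-structure defined by P *)

Section Truncation.
Variables (D : triCat) (P : set D).
Implicit Types (X Y Z A B : D) (q i : int).

Lemma DleE q : Dle P q = le P q.
Proof.
rewrite eqEsubset; split=> X; last first.
  move=> lX; exists X⟦q⟧.
    by move=> i i0 A _ PA -> f; move: i i0 A PA f; apply/le_shz; rewrite add0r.
  apply: isoc_sym; apply: isoc_trans (shz_add _ _ _) _; rewrite subrr.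
  exact: isoc_refl.
move=> [A lA /isoc_sym XA]; apply: le_iso XA _; apply/le_shz; rewrite subrr.
by move=> i i0 B PB; apply: (lA i i0 B).
Qed.

Lemma DgeE q : Dge P q = ge P q.
Proof.
rewrite eqEsubset; split=> X; last first.
  move=> lX; exists X⟦q⟧.
    by move=> i i0 A _ PA -> f; move: i i0 A PA f; apply/ge_shz; rewrite add0r.
  apply: isoc_sym; apply: isoc_trans (shz_add _ _ _) _; rewrite subrr.
  exact: isoc_refl.
move=> [A lA /isoc_sym XA]; apply: ge_iso XA _; apply/ge_shz; rewrite subrr.
by move=> i i0 B PB; apply: (lA i i0 B).
Qed.

Hypothesis P_tstr : t_structure (Dle0 P) (Dge0 P).

Lemma orth_le_ge q A B : le P q A -> ge P (q + 1) B -> orth A B.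
Proof.
case: P_tstr => _ _ _ h0 _ lA gB.
have {}h0 X Y : le P 0 X -> ge P 1 Y -> orth X Y.
  move=> lX gY; apply: (h0 X Y); first by move=> i i0 U _ PU ->; apply: lX.
  by have : Dge P 1 Y by rewrite DgeE.
apply/(orth_shz q)/h0; first by apply/le_shz; rewrite add0r.
by apply/ge_shz; rewrite addrC.
Qed.

Lemma truncation q X :
  exists A B, [/\ le P q A, ge P (q + 1) B & triangle A X B].
Proof.
case: P_tstr => _ _ _ _ st.
have : starc (Dle0 P) (shiftc (Dge0 P) (-1)) X⟦q⟧ by rewrite st.
move=> /starc_triangle[A [B [lA gB t]]].
exists A⟦-q⟧, B⟦-q⟧; split.
- by apply/le_shz; rewrite subrr; move=> i i0 U PU; apply: (lA i i0 U).
- apply/ge_shz; rewrite addrC addKr.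
  by have : Dge P 1 B by []; rewrite DgeE.
- apply: triangle_iso (isoc_refl _) _ (isoc_refl _) (triangle_shz (- q) t).
  by apply: isoc_trans (shz_add _ _ _) _; rewrite subrr; apply: isoc_refl.
Qed.

Lemma le_ge_zero q X : le P q X -> ge P (q + 1) X -> is_zero X.
Proof. by move=> lX gX; apply: (orth_le_ge lX gX). Qed.

(** The complementary piece lies in both D^{<=q} and D^{>=q+1}, hence is zero. *)
Lemma trunc_leE q X A : le P q X -> trunc_le P q X A -> isoc X A.
Proof.
rewrite /trunc_le DleE DgeE => lX [B [f [g [h [lA gB t]]]]].
have {}t : triangle A X B by exists f, g, h.
apply/isoc_sym/(triangle_zeror t)/(le_ge_zero _ gB).
by apply: le_cone t _ lX; apply: le_mono lA; lia.
Qed.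

Lemma trunc_geE p X B : ge P p X -> trunc_ge P p X B -> isoc X B.
Proof.
rewrite /trunc_ge DleE DgeE => gX [A [f [g [h [lA gB t]]]]].
have {}t : triangle A X B by exists f, g, h.
apply: (triangle_zerol t); apply: le_ge_zero lA _; rewrite subrK.
by apply: ge_cocone t gX _; apply: ge_mono gB; lia.
Qed.

Lemma Htrunc_refl p q X : le P q X -> ge P p X -> Htrunc P p q X X.
Proof.
move=> lX gX; have [O O0] := has_zero D.
exists X; rewrite /trunc_le /trunc_ge DleE DgeE.
  have [f [g [h t]]] := triangle_id X O0; exists O, f, g, h; split=> //.
  exact: ge_zero.
have [f [g [h t]]] := triangle_0id X O0; exists O, f, g, h; split=> //.
exact: le_zero.
Qed.

Lemma Htrunc_isoc p q X Y : le P q X -> ge P p X -> Htrunc P p q X Y -> isoc X Y.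
Proof.
move=> lX gX [A /(trunc_leE lX) XA /trunc_geE AY].
exact: isoc_trans XA (AY (ge_iso XA gX)).
Qed.

End Truncation.

(** * Iterated extensions S * S[1] * ... * S[n] *)

Section Pint.
Variables (D : triCat) (S : set D).
Hypothesis S_sub : subcat S.
Implicit Types (X Y Z A B U : D).

Lemma shiftc_shz (T : set D) i X : T X -> shiftc T i X⟦i⟧.
Proof. by move=> TX; exists X => //; apply: isoc_refl. Qed.

Lemma Pint_iso n X Y : isoc X Y -> Pint S n Y -> Pint S n X.
Proof.
case: n => [|n] XY; first exact: subcat_iso.
move=> /starc_triangle[A [B [SA SB t]]]; apply/starc_triangle; exists A, B.
split=> //; apply: triangle_iso t; try exact: isoc_refl; exact: isoc_sym.
Qed.

(** [Pint] is bracketed to the left, so a layer added on the left is moved inward by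
    [triangle_assoc], by induction on n. *)
Lemma Pint_cons n A X Y : S A -> Pint S n Y -> triangle A X (sh Y) ->
  Pint S n.+1 X.
Proof.
move=> SA; elim: n X Y => [|n IH] X Y SY t.
  apply/starc_triangle; exists A, (sh Y); split=> //.
  exact: (shiftc_shz 1).
move: SY => /starc_triangle[B [C [SB [C' SC CC] t']]].
have [F [tF tX]] := triangle_assoc t (triangle_shz 1 t').
apply/starc_triangle; exists F, (sh C); split=> //; first exact: IH tF.
exists C' => //; exact: (Fmap_isoc _ CC).
Qed.

(** Passing from U to V lowers by one the degree in which Hom into W vanishes, because S has no
    positive extensions with values in W. *)
Lemma Pint_resolution (W : set D) n U :
    (forall V, W V -> exists V' A, [/\ W V', S A & triangle V' A V]) ->
    (forall B, W B -> le S 0 B) ->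
    W U -> (forall B, W B -> orth U B⟦n.+1⟧) ->
  Pint S n U.
Proof.
move=> res SW; elim: n U => [|n IH] U WU UW;
  have [V [A [WV SA t]]] := res U WU.
  (* For n = 0 the connecting map U -> V[1] vanishes, so U is a summand of A. *)
  have [f [g [h t']]] := t; apply: subcat_summand SA _ => //.
  apply: summand_split t' _; exact: (UW V).
apply: (Pint_cons SA) (triangle_rot t); apply: IH => // B WB.
apply: orth_trianglel1 t _ _; first by apply: SW.
by rewrite -PoszD addn1; apply: UW.
Qed.

Lemma Pint_orth n X B :
  (forall A k, S A -> (k <= n)%N -> orth A B⟦- k%:Z⟧) -> Pint S n X -> orth X B.
Proof.
elim: n X => [|n IH] X SB; first by move=> SX; apply: (SB X 0%N).
move=> /starc_triangle[A [C [SA [C' SC CC] t]]].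
apply: orth_trianglel t _ _.
  by apply: IH SA => A' k SA' kn; apply: SB => //; apply: leqW.
apply: orth_iso (isoc_sym CC) (isoc_refl _) _.
by apply/(orth_shz_sub _ 0); rewrite sub0r; apply: SB.
Qed.

Lemma Pint_ge (P : set D) q n X : (forall A, S A -> ge P q A) ->
  Pint S n X -> ge P (q - n%:Z) X.
Proof.
move=> SP; elim: n X => [|n IH] X; first by rewrite subr0; apply: SP.
move=> /starc_triangle[A [C [SA [C' SC CC] t]]]; apply: ge_ext t _ _.
  by apply: ge_mono (IH _ SA); lia.
apply: ge_iso (isoc_sym CC) _; apply/ge_shz.
by apply: ge_mono (SP _ SC); lia.
Qed.

Lemma Pint_thick n X : Pint S n X -> thick S X.
Proof.
move=> PX U [U_sub Ush Uush Uext] SU.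
have Uiter B k : U B -> U (iter k sh B).
  by move=> UB; elim: k => //= k; apply: Ush.
elim: n X PX => [|n IH] X; first exact: SU.
move=> /starc_triangle[A [C [SA [C' SC CC] /triangle_irot[f [g [h t]]]]]].
apply: Uext t _ (IH _ SA); apply: Uush; apply: subcat_iso CC _ => //.
by apply: (Uiter C' n.+1); apply: SU.
Qed.

End Pint.

Lemma dHE (D : triCat) (P : set D) d X :
  dH P d X <-> le P 0 X /\ ge P (- d%:Z + 1) X.
Proof. by rewrite /dH /Dint DleE DgeE. Qed.

Lemma TperpE (D : triCat) (P : set D) d (S : set D) X :
  Tperp P d S X <-> dH P d X /\ le S 0 X.
Proof.
split=> -[dX SX]; split=> // i i0 A; first by move=> SA; apply: (SX i i0 A).
by move=> _ SA ->; apply: SX.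
Qed.

Lemma shiftc_ext_vanish (D : triCat) (S T : set D) :
  (forall i : int, 0 < i -> Hom0 S (shiftc T i)) <->
  (forall B, T B -> le S 0 B).
Proof.
split=> [ST B TB i i0 A SA|ST i i0 A Y SA [B TB /isoc_sym YB]].
  by apply: (ST i i0) => //; apply: shiftc_shz.
by apply: orth_iso (isoc_refl _) YB _; apply: ST.
Qed.

(** * The classes Fac_s as iterated cokernels in d-H *)

Section Fac.
Variables (D : triCat) (P : set D) (d : nat) (M : set D).
Implicit Types X Y Z A B U : D.

Lemma Fac0 X : Fac P d 0 M X <-> dH P d X.
Proof.
split=> [[]//|dX]; split=> //; exists (fun=> X), (fun=> X).
by split=> // -[].
Qed.

(** Recursive form of the chain of extriangles, on which inductions over s run. *)
Lemma FacS s X : Fac P d s.+1 M X <->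
  exists Z W, [/\ M W, extriangle P d Z W X & Fac P d s M Z].
Proof.
split=> [[dX [Z [W [Z0 ZW]]]]|[Z [W [MW ZWX [_ [Z' [W' [Z'0 ZW']]]]]]]].
  have [|MW ZWX] := ZW 1%N; first by [].
  exists (Z 1%N), (W 1%N); split=> //; first by rewrite -Z0.
  split; first by case: ZWX.
  exists (fun i => Z i.+1), (fun i => W i.+1); split=> // -[//|i] i1.
  exact: ZW.
split; first by case: ZWX.
exists (fun i => if i is k.+1 then Z' k else X).
(* The middle terms are indexed from 1, so the value at 0 is a dummy. *)
exists (fun i => if i is k.+2 then W' k.+1 else W).
split=> // -[|[|i]] // i1; first by rewrite Z'0.
exact: ZW'.
Qed.

Lemma Fac_sub s : Fac P d s.+1 M `<=` Fac P d s M.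
Proof.
move=> X [dX [Z [W [Z0 ZW]]]]; split=> //; exists Z, W; split=> // i /andP[i1 si].
by apply: ZW; rewrite i1 leqW.
Qed.

Lemma sub_Fac s : subcat_dH P d M -> M `<=` Fac P d s M.
Proof.
move=> [M_sub MH]; elim: s => [|s IH] X MX; first exact/Fac0/MH.
have [O O0] := has_zero D; have MO := subcat_zero M_sub O0.
apply/FacS; exists O, X; split=> //; last exact: IH.
by split; try exact: MH; apply: triangle_0id.
Qed.

Lemma sub_Fac_resolution (T : set D) s : T `<=` dH P d ->
    (forall X, T X -> exists Z N, [/\ M N, T Z & extriangle P d Z N X]) ->
  T `<=` Fac P d s M.
Proof.
move=> TH res; elim: s => [|s IH] X TX; first exact/Fac0/TH.
have [Z [N [MN TZ t]]] := res X TX; apply/FacS; exists Z, N; split=> //.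
exact: IH.
Qed.

End Fac.

(** * P-covers, projective dimension and P^{[0,n]} *)

Section Silting.
Variables (D : triCat) (P : set D) (d : nat).
Hypothesis P_sub : subcat P.
Hypothesis P_rigid : forall A, P A -> le P 0 A.
Hypothesis P_cf : contrafinite P setT.
Hypothesis P_tstr : t_structure (Dle0 P) (Dge0 P).
Hypothesis d_gt0 : (0 < d)%N.
Hypothesis P_dH : P `<=` dH P d.
Implicit Types X Y Z A B U : D.

Lemma dH_cocone_ge X Y Z :
  triangle X Y Z -> dH P d Y -> dH P d Z -> ge P (- d%:Z + 1) X.
Proof.
move=> t /dHE[_ gY] /dHE[_ gZ]; apply: ge_cocone t gY _.
by apply: ge_mono gZ; lia.
Qed.

(** V is the cocone of a right P-approximation; rigidity of P and the lifting of maps from P keep it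
    in D^{<=0}. *)
Lemma P_cover U : le P 0 U -> exists V A, [/\ le P 0 V, P A & triangle V A U].
Proof.
move=> lU; have [//|A [f [PA fP]]] := P_cf (Y := U).
have [Z [g [h /tri_irot[h' [k t]]]]] := tri_ex f.
exists (ush Z), A; split=> //; last by exists h', f, k.
by apply: (le_cocone t) => //; [exact: P_rigid|move=> B PB u; apply: fP].
Qed.

Lemma Pint_P_orth n X B : Pint P n X -> le P (- n%:Z - 1) B -> orth X B.
Proof.
by move=> PX lB; apply: Pint_orth PX => // A k PA kn; apply: lB => //; lia.
Qed.

(** The definition asks for extriangles in every positive degree, so the resolution is padded with
    zero objects. *)
Lemma projdim0 X : P X -> projdim_le P d 0 X.
Proof.
move=> PX; have [O O0] := has_zero D; have PO := subcat_zero P_sub O0.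
exists (fun i => if i is 0%N then X else O), (fun i => if i is 0%N then X else O).
split=> // -[//|i] _; have PXO : P (if i is 0%N then X else O) by case: i.
split=> //=; split; try exact: P_dH.
exact: triangle_0id.
Qed.

Lemma projdimS n X Z A : P A -> extriangle P d Z A X -> projdim_le P d n Z ->
  projdim_le P d n.+1 X.
Proof.
move=> PA ZAX [Z' [Q [Z0 Zn ZQ]]].
exists (fun i => if i is k.+1 then Z' k else X).
exists (fun i => if i is k.+1 then Q k else A).
split=> // -[//|[|i]] _; first by rewrite Z0.
exact: (ZQ i.+1).
Qed.

(** The argument of [Pint_resolution] carried out inside d-H: the cocone of a P-cover of an object
    of d-H is again in d-H. *)
Lemma projdim_of_orth n X :
  dH P d X -> (forall B, dH P d B -> orth X B⟦n.+1⟧) -> projdim_le P d n X.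
Proof.
elim: n X => [|n IH] X dX XB; have [lX _] := (dHE _ _ _).1 dX;
  have [V [A [lV PA t]]] := P_cover lX;
  have dV : dH P d V
    by apply/dHE; split=> //; apply: dH_cocone_ge t _ dX; apply: P_dH.
  apply: projdim0; have [f [g [h t']]] := t.
  by apply: subcat_summand PA _ => //; apply: summand_split t' _; apply: (XB V).
have ZAX : extriangle P d V A X by split=> //; apply: P_dH.
apply: (projdimS PA ZAX); apply: IH => // B dB.
have [lB _] := (dHE _ _ _).1 dB.
apply: orth_trianglel1 t _ _; first by apply: lB.
by rewrite -PoszD addn1; apply: XB.
Qed.

Lemma projdim_orth n X B : projdim_le P d n X -> le P (- n%:Z - 1) B -> orth X B.
Proof.
elim: n X B => [|n IH] X B [Z [Q [Z0 Zn ZQ]]] lB.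
  by rewrite -Z0; apply: (lB 0).
have [//|PQ [_ _ _ t]] := ZQ 1%N.
rewrite Z0 /= in t; apply: orth_trianglel (triangle_rot t) _ _.
  by apply: (lB 0) => //; lia.
apply: orth_iso (isoc_refl _) (sh_ush B) _; apply/orth_sh/IH.
  exists (fun i => Z i.+1), (fun i => Q i.+1); split=> // -[//|i] _.
  exact: (ZQ i.+2).
by apply/(le_shz _ _ (-1)); apply: le_mono lB; lia.
Qed.

Lemma Pint_of_orth n X :
  le P 0 X -> (forall B, le P (- n%:Z - 1) B -> orth X B) -> Pint P n X.
Proof.
move=> lX XB; apply: (Pint_resolution _ (W := le P 0)) => //.
  exact: P_cover.
by move=> B lB; apply: XB; apply/le_shz; apply: le_mono lB; lia.
Qed.

(** * Right M-approximations and triangles *)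

Section Terms.
Variable M : set D.
Hypothesis M_subcat : subcat_dH P d M.
Hypothesis M_cf : contrafinite M (dH P d).
Hypothesis M_univ : E_universal P d M.

Let M_sub : subcat M := M_subcat.1.
Let M_dH : M `<=` dH P d := M_subcat.2.

Lemma M_le X : M X -> le P 0 X.
Proof. by move=> /M_dH/dHE[]. Qed.

Lemma M_ge X : M X -> ge P (- d%:Z + 1) X.
Proof. by move=> /M_dH/dHE[]. Qed.

(** A horseshoe argument: b lifts to b' : B0 -> Y, and the sum A0 + B0 approximates Y, since any map
    from M to Y differs from one through b' by a map through A. *)
Lemma approx_triangle A Y B (f : Hom A Y) (g : Hom Y B) (h : Hom B (sh A))
    A0 B0 (a : Hom A0 A) (b : Hom B0 B) :
    tri f g h -> right_approx M a -> right_approx M b ->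
    (forall N, M N -> forall u : Hom N B, exists v, u = g ∘ v) ->
  exists (N : D) (c : Hom N Y), right_approx M c.
Proof.
move=> t [MA aP] [MB bP] lift; have [b' bb'] := lift _ MB b.
have [N AB] := has_biprod A0 B0; have MN := subcat_biprod M_sub AB MA MB.
move: AB => [iA [iB [pA [pB [e1 e2 e3 e4 _]]]]].
exists N, (f ∘ a ∘ pA + b' ∘ pB); split=> // N' u MN'.
have [v ev] := bP N' (g ∘ u) MN'.
have [|w ew] := tri_wker (u := u - b' ∘ v) t.
  by rewrite compDr compmN compmA -bb' ev subrr.
have [x ex] := aP N' w MN'; exists (iA ∘ x + iB ∘ v).
rewrite compDl !compDr -!compmA !(compmA pA) !(compmA pB) e1 e2 e3 e4.
by rewrite !comp1m !comp0m !compm0 addr0 add0r -ex -ew subrK.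
Qed.

Definition has_approx Y := exists (N : D) (c : Hom N Y), right_approx M c.

Lemma has_approx_orth Y : (forall N, M N -> orth N Y) -> has_approx Y.
Proof.
move=> MY; have [O O0] := has_zero D; exists O, 0; split.
  exact: subcat_zero.
by move=> N u MN; exists 0; rewrite (MY N MN u) compm0.
Qed.

Lemma has_approx_iso Y Y' : isoc Y Y' -> has_approx Y -> has_approx Y'.
Proof.
move=> [f [g [gf fg]]] [N [c [MN cP]]]; exists N, (f ∘ c); split=> // N' u MN'.
have [v ev] := cP N' (g ∘ u) MN'; exists v.
by rewrite -compmA -ev compmA fg comp1m.
Qed.

Lemma has_approx_triangle A Y B : triangle A Y B -> has_approx A ->
  has_approx B -> (forall N, M N -> orth N (sh A)) -> has_approx Y.
Proof.
move=> [f [g [h t]]] [A0 [a aP]] [B0 [b bP]] MA.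
apply: (approx_triangle t aP bP) => N MN u.
apply: tri_wker ((tri_rot _ _ _).1 t) _.
exact: MA.
Qed.

Lemma has_approx_trianglel A Y B : triangle A Y B -> has_approx A ->
  (forall N, M N -> orth N B) -> has_approx Y.
Proof.
move=> [f [g [h t]]] [A0 [a aP]] MB; have [B0 [b bP]] := has_approx_orth MB.
apply: (approx_triangle t aP bP) => N MN u; exists 0.
by rewrite compm0; apply: MB.
Qed.

(** The connecting map of a universal extriangle is the approximation of X[1]. *)
Lemma has_approx_sh X : dH P d X -> has_approx (sh X).
Proof.
move=> dX; have [Y [N [f [g [h [_ MN _ hP]]]]]] := M_univ dX.
by exists N, h; split=> // N' u MN'; have [v <-] := hP N' MN' u; exists v.
Qed.

(** * Consequences of M lying in P^{[0,d]} *)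

Section Bounded.
Hypothesis M_Pint : M `<=` Pint P d.

Lemma M_orth N B q : M N -> le P q B -> q <= - d%:Z - 1 -> orth N B.
Proof.
by move=> /M_Pint PN lB qd; apply: Pint_P_orth PN _; apply: le_mono lB.
Qed.

Lemma M_orth_le q B : le P q B -> le M (q + d%:Z) B.
Proof.
move=> lB i qi N MN; apply: (@M_orth _ _ (q - i)) => //; last by lia.
by apply/le_shz; rewrite subrK.
Qed.

Lemma contrafinite_all : contrafinite M setT.
Proof.
move=> Y _; rewrite -/(has_approx Y).
have [A0 [B0 [lA0 gB0 t0]]] := truncation P_tstr 0 Y.
apply: (has_approx_trianglel t0); last first.
  by move=> N MN; apply: orth_le_ge gB0 => //; exact: M_le.
have [A1 [B1 [lA1 gB1 t1]]] := truncation P_tstr (- d%:Z) A0.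
have dB1 : dH P d B1.
  by apply/dHE; split=> //; apply: le_cone t1 _ lA0; apply: le_mono lA1; lia.
(* Maps from M to B1 lift to A0 because A1[1] lies in D^{<=-d-1}, which M kills. *)
apply: (has_approx_triangle t1 _ (M_cf dB1)); last first.
  move=> N MN; apply: (@M_orth _ _ (- d%:Z - 1)) => //.
  by apply/(le_shz _ _ 1); rewrite subrK.
(* B2 is concentrated in degree -d, so B2[-1] lies in d-H and [has_approx_sh] applies to it. *)
have [A2 [B2 [lA2 gB2 t2]]] := truncation P_tstr (- d%:Z - 1) A1.
apply: (has_approx_triangle t2); last first.
- move=> N MN; apply: (@M_orth _ _ (- d%:Z - 2)) => //; last by lia.
  by apply/(le_shz _ _ 1); apply: le_mono lA2; lia.
- apply: (has_approx_iso (sh_ush B2)); apply: has_approx_sh.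
  apply/dHE; split.
    apply/(le_shz _ _ (-1)); apply: le_cone t2 _ _.
      by apply: le_mono lA2; lia.
    by apply: le_mono lA1; lia.
  by apply/(ge_shz _ _ (-1)); apply: ge_mono gB2; lia.
apply: has_approx_orth => N MN; apply: (@M_orth _ _ (- d%:Z - 1)) => //.
Qed.

Hypothesis M_rigid : forall N, M N -> le M 0 N.

(** An arbitrary object of d-H satisfies the bound d, and each extriangle with middle term in M
    improves it by one. *)
Lemma Fac_le s X : (s <= d)%N -> Fac P d s M X -> le M (d%:Z - s%:Z) X.
Proof.
elim: s X => [|s IH] X sd.
  by move=> /Fac0/dHE[lX _]; rewrite subr0 -[d%:Z]add0r; apply: M_orth_le.
move=> /FacS[Z [W [MW [_ _ _ t] FZ]]]; apply: le_cone t _ _.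
  by apply: le_mono (IH _ _ FZ); lia.
by apply: le_mono (M_rigid MW); lia.
Qed.

Lemma Fac_Tperp : Fac P d d M `<=` Tperp P d M.
Proof.
move=> X FX; apply/TperpE; split; first by case: FX.
by have := Fac_le (leqnn d) FX; rewrite subrr.
Qed.

End Bounded.

(** The existence clause of (4), through which all the implications pass. *)
Definition Tperp_resolved := forall X, Tperp P d M X ->
  exists Z N, [/\ M N, Tperp P d M Z & extriangle P d Z N X].

(** Take the cocone of a right M-approximation. Maps from P to X factor through M, hence through the
    approximation, which gives D^{<=0}; rigidity and the approximation property give T(M). *)
Lemma Tperp_cocone X : (forall N, M N -> le M 0 N) -> Tperp P d M X ->
    (forall A, P A -> forall u : Hom A X,
       exists N (v : Hom A N) (w : Hom N X), M N /\ u = w ∘ v) ->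
  exists Z N, [/\ M N, Tperp P d M Z & extriangle P d Z N X].
Proof.
move=> M_rigid /TperpE[dX MX] fact; have [N [f [MN fP]]] := M_cf dX.
have [lX _] := (dHE _ _ _).1 dX.
have [C [g [h /tri_irot[h' [k t]]]]] := tri_ex f.
have tC : triangle (ush C) N X by exists h', f, k.
have dZ : dH P d (ush C).
  apply/dHE; split; last exact: dH_cocone_ge tC (M_dH MN) dX.
  apply: (le_cocone t) => //; first exact: M_le.
  move=> A PA u; have [N' [v [w [MN' ->]]]] := fact A PA u.
  by have [x ->] := fP N' w MN'; exists (x ∘ v); rewrite compmA.
exists (ush C), N; split=> //; last by split=> //; apply: M_dH.
apply/TperpE; split=> //; apply: (le_cocone t) => //; first exact: M_rigid.
by move=> A MA u; apply: fP.
Qed.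

Lemma tilting_factor X : tilting P d M -> le M 0 X ->
  forall A, P A -> forall u : Hom A X,
    exists N (v : Hom A N) (w : Hom N X), M N /\ u = w ∘ v.
Proof.
move=> [_ _ cores] MX A PA u; have [r [Y [N [Y0 Yr YN]]]] := cores A PA.
case: A / Y0 PA u {cores} => _ u.
case: r Yr YN => [MY _|r Yr YN].
  by exists (Y 0%N), (idC _), u; rewrite compm1.
(* Descending induction from the last term, which lies in M, down to Y_1 at k = r. *)
have YX k : (k <= r)%N -> forall i : int, 0 < i -> orth (Y (r.+1 - k)%N) X⟦i⟧.
  elim: k => [|k IH] kr i i0; first by rewrite subn0; apply: MX.
  have e : (r.+1 - k = (r.+1 - k.+1).+1)%N by lia.
  have [|MN [_ _ _]] := YN (r.+1 - k)%N; first by lia.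
  rewrite e /= => t; apply: orth_trianglel1 t _ _.
    by apply: MX => //; move: MN; rewrite e.
  by rewrite -e; apply: IH; lia.
have {}YX : orth (Y 1%N) X⟦1⟧ by have := YX r (leqnn r) 1 isT; rewrite subSnn.
have [//|MN [_ _ _ [f [g [h /tri_irot[h' [k t]]]]]]] := YN 1%N.
have [|w ->] := tri_wcoker (u := u) t.
  by have /(orth_shz_sub (-1) 0) := YX; apply.
by exists (N 0%N), f, w.
Qed.

Lemma tilting_resolved : tilting P d M -> Tperp_resolved.
Proof.
move=> tM X TX; apply: Tperp_cocone => //.
  by case: tM => _ /shiftc_ext_vanish.
by move: TX => /TperpE[_ MX]; apply: tilting_factor.
Qed.

(** M lies in Fac_d, hence is rigid. As d > 0, X is the end of an extriangle Z -> W -> X with W in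
    M, and maps from P lift to W because Z lies in D^{<=0}. *)
Lemma resolved_of_Fac : Tperp P d M = Fac P d d M -> Tperp_resolved.
Proof.
move=> TF X TX; apply: Tperp_cocone => //.
  move=> N MN; have : Tperp P d M N by rewrite TF; apply: sub_Fac.
  by case/TperpE.
have : Fac P d d.-1.+1 M X by rewrite prednK // -TF.
move=> /FacS[Z [W [MW [/dHE[lZ _] _ _ [f [g [h t]]]] _]]] A PA u.
by have [v ->] := le_cocone_surj u t lZ PA; exists W, v, g.
Qed.

(** * From condition (4) to tilting *)

Section Converse.
Hypothesis M_Pint : M `<=` Pint P d.
Hypothesis M_rigid : forall N, M N -> le M 0 N.
Hypothesis M_res : Tperp_resolved.

(** V is the cocone of a right M-approximation of U. That it stays in D^{<=0} is reduced to
    condition (4) for the truncation X of U in d-H. *)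
Lemma resolution U : le P 0 U -> le M 0 U ->
  exists V N, [/\ le P 0 V, le M 0 V, M N & triangle V N U].
Proof.
move=> lU MU; have [//|N [f [MN fP]]] := contrafinite_all M_Pint (Y := U).
have [C [g [h /tri_irot[h' [k t]]]]] := tri_ex f.
exists (ush C), N; split=> //; last by exists h', f, k.
  apply: (le_cocone t) => //; first exact: M_le.
  have [A [X [lA gX tX]]] := truncation P_tstr (- d%:Z) U.
  have MA : le M 0 A by apply: le_mono (M_orth_le M_Pint lA); lia.
  have TX : Tperp P d M X.
    apply/TperpE; split.
      by apply/dHE; split=> //; apply: le_cone tX _ lU; apply: le_mono lA; lia.
    by apply: le_cone tX _ MU; apply: le_mono MA.
  have [Z [N1 [MN1 /TperpE[/dHE[lZ _] _] [_ _ _ [z [m [z' tZ]]]]]]] := M_res TX.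
  move=> B PB u; move: tX => [a [x [y tX]]].
  (* The map N1 -> X lifts to U; a map u from P to U then agrees with one through N1 up to a map
     into A, and P has no nonzero map to A since A lies in D^{<=-d}. *)
  have [m' em] := le_cocone_surj m tX MA MN1.
  have [v ev] := le_cocone_surj (x ∘ u) tZ lZ PB.
  have [|w ew] := tri_wker (u := u - m' ∘ v) tX.
    by rewrite compDr compmN compmA -em ev subrr.
  have [n en] := fP _ m' MN1; exists (n ∘ v); rewrite compmA -en.
  by apply: subr0_eq; rewrite ew (lA 0 _ B PB w) ?compm0 //; lia.
apply: (le_cocone t) => //; first exact: M_rigid.
by move=> B MB u; apply: fP.
Qed.

(** The shift by d is what makes Hom(M, A[d][i]) vanish for i > 0, while Hom(A[d], B[d+1]) = Hom(A,
    B[1]) = 0 for B in D^{<=0}. *)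
Lemma P_Pint A : P A -> Pint M d A⟦d⟧.
Proof.
move=> PA; apply: (Pint_resolution _ (W := le P 0 `&` le M 0)) => //.
- by move=> V [lV MV]; have [V' [N [? ? ? ?]]] := resolution lV MV; exists V', N.
- by move=> B [].
- have lA : le P (- d%:Z) A⟦d⟧ by apply/le_shz; rewrite addNr; apply: P_rigid.
  split; first by apply: le_mono lA; lia.
  by have := M_orth_le M_Pint lA; rewrite addNr.
- by move=> B [lB _]; apply/orth_shz_sub; apply: lB => //; lia.
Qed.

(** The outermost layer M[n] of X[n], shifted back, gives the first map X -> N. The lower bound for
    d-H comes from the layers and the upper one from taking cones. *)
Lemma coresolution n X : le P 0 X -> Pint M n X⟦n⟧ ->
  exists (r : nat) (Y N : nat -> D),
    [/\ Y 0%N = X, M (Y r)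
      & forall i, (1 <= i <= r)%N ->
          M (N i.-1) /\ extriangle P d (Y i.-1) (N i.-1) (Y i)].
Proof.
have dX k Y : le P 0 Y -> Pint M k Y⟦k⟧ -> dH P d Y.
  move=> lY /(Pint_ge M_ge)/ge_shz gY; apply/dHE; split=> //.
  by apply: ge_mono gY; lia.
elim: n X => [|n IH] X lX PX.
  by exists 0%N, (fun=> X), (fun=> X); split=> // -[].
have dHX := dX _ _ lX PX.
move: PX => /starc_triangle[A [C [PA [N MN CN] t]]].
(* This is the cone of X -> N, and X'[n] is isomorphic to A, so the induction continues with X'. *)
pose X' := sh A⟦- n.+1%:Z⟧.
have tX : triangle X N X'.
  apply: triangle_rot; apply: triangle_iso (triangle_shz (- n.+1%:Z) t).
  - exact: isoc_refl.
  - by apply: isoc_trans (shz_add _ _ _) _; rewrite subrr; apply: isoc_refl.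
  - apply: isoc_trans (isoc_shz _ CN) _.
    by apply: isoc_trans (shz_add _ _ _) _; rewrite subrr; apply: isoc_refl.
have lX' : le P 0 X'.
  by apply: le_cone tX _ (M_le MN); apply: le_mono lX.
have PX' : Pint M n X'⟦n⟧.
  apply: Pint_iso PA => //; apply: isoc_trans (shz_add 1 n _) _.
  apply: isoc_trans (shz_add _ _ _) _.
  have -> : - n.+1%:Z + (1 + n%:Z) = 0 by lia.
  exact: isoc_refl.
have [r [Y [N' [Y0 Yr YN]]]] := IH X' lX' PX'.
exists r.+1, (fun i => if i is k.+1 then Y k else X).
exists (fun i => if i is k.+1 then N' k else N); split=> // -[//|[_|i i1]].
  by rewrite Y0; split=> //; split=> //; [apply: M_dH|apply: dX PX'].
exact: (YN i.+1).
Qed.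

Lemma tilting_of_resolved : tilting P d M.
Proof.
split=> [X MX||A PA].
- apply: projdim_of_orth; first exact: M_dH.
  move=> B /dHE[lB _]; apply: (M_orth_le M_Pint lB) => //; lia.
- exact/shiftc_ext_vanish.
- by apply: coresolution (P_Pint PA); apply: P_rigid.
Qed.

End Converse.

Lemma tilting_Pint : tilting P d M -> M `<=` Pint P d.
Proof.
move=> [pd _ _] X MX; apply: Pint_of_orth; first exact: M_le.
by move=> B lB; apply: projdim_orth (pd X MX) lB.
Qed.

(** Objects of M already lie in d-H, so truncation changes them only up to isomorphism. *)
Lemma self_presentation : M `<=` Pint P d -> P_presentation P d M M.
Proof.
move=> M_Pint; split.
  by split=> // X /M_Pint; apply: Pint_thick.
rewrite [RHS]M_sub; congr addc; rewrite eqEsubset; split=> [Y [X MX HXY]|X MX].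
  apply: (subcat_iso M_sub _ MX); apply/isoc_sym/(Htrunc_isoc P_tstr _ _ HXY).
    exact: M_le.
  exact: M_ge.
by exists X => //; apply: Htrunc_refl; [apply: M_le|apply: M_ge].
Qed.

End Terms.
End Silting.

(** * The cycle of implications (1), (2), (3), (4), (1) *)

Theorem proposition4p5 (D : triCat) (P : set D)
    (P_presilting : presilting P)
    (P_cf : contrafinite P setT)
    (P_bounded : exists2 m : int, m < 0 &
       forall i : int, i < m -> Hom0 P (shiftc P i))
    (P_tstr : t_structure (Dle0 P) (Dge0 P))
    (P_nondeg : non_degenerate (Dle0 P) (Dge0 P))
    (d : nat) (d_gt0 : (0 < d)%N)
    (P_dH : P `<=` dH P d)
    (M : set D)
    (M_subcat : subcat_dH P d M)
    (M_cf : contrafinite M (dH P d))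
    (M_univ : E_universal P d M) :
  [<-> tilting P d M;
       P_presentation P d M M /\ AIR_tilting P d M M;
       M `<=` Pint P d /\
         (Tperp P d M = Fac P d d M /\ Fac P d d M = Fac P d d.+1 M);
       M `<=` Pint P d `&` Tperp P d M /\
         forall X, Tperp P d M X ->
           exists Z M0 : D, [/\ M M0, Tperp P d M Z & extriangle P d Z M0 X]].
Proof.
have [P_sub /shiftc_ext_vanish P_rigid] := P_presilting.
have T_sub : Tperp P d M `<=` dH P d by move=> X [].
have M_sub_T : Tperp P d M = Fac P d d M -> M `<=` Tperp P d M.
  by move=> ->; apply: sub_Fac.
split; [|split; [|split]].
- move=> tM; have M_Pint : M `<=` Pint P d by apply: tilting_Pint tM.
  have M_rigid := (shiftc_ext_vanish M M).1 (let: And3 _ r _ := tM in r).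
  split; first exact: self_presentation.
  split; first exact: (contrafinite_all P_tstr d_gt0).
  rewrite eqEsubset; split; last exact: Fac_Tperp.
  by apply: sub_Fac_resolution => //; apply: tilting_resolved.
- move=> [[[_ _ M_Pint] _] [_ TF]]; split=> //; split=> //.
  rewrite eqEsubset; split; last exact: Fac_sub.
  (* Resolutions inside T(M) can be iterated any number of times, in particular d + 1 times. *)
  rewrite -TF; apply: sub_Fac_resolution => //; exact: resolved_of_Fac.
- move=> [M_Pint [TF _]]; split; last exact: resolved_of_Fac.
  by move=> X MX; split; [apply: M_Pint|apply: M_sub_T].
- move=> [M_PT res].
  by apply: tilting_of_resolved => // X /M_PT[] // _ /TperpE[].
Qed.
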